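(* Let $X,Y$ be finite-dimensional Hilbert spaces, $\varphi:X\times Y\to(-\infty,+\infty]$ closed, proper and convex, $C:Y\to Y$ self-adjoint positive definite, and $B(x,y):=(0,C^{-1}y)$ on $X\times Y$. Fix $c>0$. For any current point $(\widehat x,\widehat y)\in X\times Y$, a pair $(x^+,y^+)\in X\times Y$ solves the $(c,B)$-step for $T_\ell$ on $X\times Y$, $$0\in T_\ell(x^+,y^+)+c^{-1}B\bigl((x^+,y^+)-(\widehat x,\widehat y)\bigr),$$ if and only if there exists $u^+\in Y$ such that $$(x^+,u^+)\in\operatorname*{argmin}_{x\in X,\,u\in Y}\Bigl\{\varphi(x,u)-\langle\widehat y,u\rangle+\frac c2\|u\|_C^2\Bigr\},\qquad y^+=\widehat y-cCu^+.\tag{A}$$ Equivalently, the joint minimization in (A) can be carried out in two stages: $$x^+\in\operatorname*{argmin}_{x\in X}\ell_{c,C}(x,\widehat y),\qquad u^+\in\operatorname*{argmin}_{u\in Y}\Bigl\{\varphi(x^+,u)-\langle\widehat y,u\rangle+\frac c2\|u\|_C^2\Bigr\}.$$ Whenever the step exists, $u^+$ and $y^+$ are uniquely determined, whereas the set of possible primal components $x^+$ is exactly $(T_\ell)_{**}(y^+,u^+)$. The semidefinite proximal scheme for $T_\ell$, relative to the splitting $H_*=\{0\}\times Y$, $H_{**}=X\times\{0\}$ of $X\times Y$, is implementable if and only if $(T_\ell)_*$ is maximal monotone, which is also equivalent to the existence of a minimizer in (A) for every $\widehat y\in Y$. If, in addition, $\psi$ is proper, these conditions are further equivalent to $(T_\ell)_*=T_g$.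 In that case, $$y^+=(I+cCT_g)^{-1}\widehat y.$$
   Context: The dual function is $\psi(y):=\varphi^*(0,y)$, where $\varphi^*$ is the convex conjugate of $\varphi$ (equivalently $\psi(y)=-\inf_{x}\ell(x,y)$ with Lagrangian $\ell(x,y):=\inf_{u\in Y}\{\varphi(x,u)-\langle y,u\rangle\}$), and $T_g:=\partial\psi$. For a self-adjoint positive definite $C$, $\|u\|_C:=\sqrt{\langle Cu,u\rangle}$. The Lagrangian saddle mapping $T_\ell:X\times Y\rightrightarrows X\times Y$ is $$T_\ell(x,y):=\{(v,u)\in X\times Y\mid(v,y)\in\partial\varphi(x,u)\}.$$ The augmented Lagrangian function is $$\ell_{c,C}(x,y):=\inf_{u\in Y}\Bigl\{\varphi(x,u)-\langle y,u\rangle+\frac c2\|u\|_C^2\Bigr\}.$$ Identifying $H_*=\{0\}\times Y$ with $Y$ and $H_{**}=X\times\{0\}$ with $X$, the projected mapping $(T_\ell)_*:Y\rightrightarrows Y$ and the completion mapping $(T_\ell)_{**}:Y\times Y\rightrightarrows X$ are $$(T_\ell)_*(y)=\{u\in Y\mid\exists x\in X:\ (0,y)\in\partial\varphi(x,u)\},\qquad(T_\ell)_{**}(y,u)=\{x\in X\mid(0,y)\in\partial\varphi(x,u)\}.$$ A self-adjoint positive semidefinite operator $B'$ on $X\times Y$ is aligned with the splitting if its range is $H_*$ and its kernel is $H_{**}$. The semidefinite proximal scheme for $T_\ell$ relative to the splitting is implementable if, for every $c'>0$, every aligned $B'$ and every $p\in X\times Y$, the inclusion $0\in T_\ell(z)+(c')^{-1}B'(z-p)$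 has at least one solution $z\in X\times Y$. *)

(* Defs.v *)
From HB Require Import structures.
From mathcomp Require Import all_boot all_order all_algebra.
From mathcomp Require Import sesquilinear.
From mathcomp Require Import all_classical all_reals.
From mathcomp Require Import ereal topology normedtype.

Set Implicit Arguments.
Unset Strict Implicit.
Unset Printing Implicit Defensive.

Import Order.TTheory GRing.Theory Num.Theory.
Import numFieldNormedType.Exports.

Local Open Scope classical_set_scope.
Local Open Scope ring_scope.

(* A finite-dimensional real Hilbert space: the norm (hence the topology) is
   the one of the inner product, and completeness is automatic. *)
HB.mixin Record NormedModule_isHilbert (R : realType) V
    of NormedModule R V := {
  dotp : {dot V for (@idfun R)} ;
  dotp_normE : forall x : V, dotp x x = `|x| ^+ 2
}.

#[short(type="finHilbertType")]
HB.structure Definition FinHilbert (R : realType) :=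
  {V of NormedModule_isHilbert R V & NormedModule R V & Vector R V}.

(* The canonical norm of a product is the maximum of the two norms, which has
   the right topology but is not Hilbertian; the inner product of the Hilbert
   space [X * Y] is therefore given separately. *)
Definition pair_dotp (R : realType) (X Y : finHilbertType R)
    (z w : X * Y) : R :=
  dotp z.1 w.1 + dotp z.2 w.2.

Section ExtendedRealFunctions.
Local Open Scope ereal_scope.
Variables (R : realType) (U : lmodType R) (d : U -> U -> R).
Implicit Types f : U -> \bar R.

Definition proper_fun f :=
  (exists x, f x < +oo) /\ (forall x, -oo < f x).

Definition econvex f := forall (x y : U) (t : R), (0 < t < 1)%R ->
  f (t *: x + (1 - t) *: y)%R <= t%:E * f x + (1 - t)%:E * f y.

Definition fenchel_conjugate f (y : U) : \bar R :=
  ereal_sup (range (fun x => (d y x)%:E - f x)).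

Definition subdiff f (x : U) : set U :=
  [set g | f x \is a fin_num /\
           forall y, f x + (d g (y - x)%R)%:E <= f y].

End ExtendedRealFunctions.

Definition argmin (R : realType) (T : Type) (f : T -> \bar R) : set T :=
  [set x | forall y, (f x <= f y)%E].

Section Operators.
Variables (R : realType) (U : lmodType R) (d : U -> U -> R).

Definition self_adjoint (A : U -> U) := forall x y, d (A x) y = d x (A y).

Definition pos_def (A : U -> U) := forall x, x != 0 -> 0 < d (A x) x.

Definition pos_semidef (A : U -> U) := forall x, 0 <= d (A x) x.

(* A set-valued mapping [T : U => U] is a function [T : U -> set U]. *)

Definition monotone_map (T : U -> set U) := forall x y u v,
  T x u -> T y v -> 0 <= d (x - y) (u - v).

Definition maximal_monotone (T : U -> set U) := monotone_map T /\
  forall S : U -> set U, monotone_map S -> (forall x, T x `<=` S x) ->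
    forall x, S x `<=` T x.

(* (I + A T)^-1 *)
Definition resolvent (A : U -> U) (T : U -> set U) (p : U) : set U :=
  [set x | [set x + A u | u in T x] p].

(* 0 \in T z + c^-1 B (z - p) *)
Definition prox_step (T : U -> set U) (c : R) (B : U -> U) (p z : U) : Prop :=
  [set w + c^-1 *: B (z - p) | w in T z] 0.

End Operators.

Section Saddle.
Variables (R : realType) (X Y : finHilbertType R).
Variable phi : X * Y -> \bar R.

Definition dual_fun (y : Y) : \bar R :=
  fenchel_conjugate (@pair_dotp R X Y) phi (0, y).

Definition dual_map : Y -> set Y := subdiff dotp dual_fun.

Definition saddle_map (z : X * Y) : set (X * Y) :=
  [set w | subdiff (@pair_dotp R X Y) phi (z.1, w.2) (w.1, z.2)].

Definition saddle_proj (y : Y) : set Y :=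
  [set u | exists x, subdiff (@pair_dotp R X Y) phi (x, u) (0, y)].

Definition saddle_compl (y u : Y) : set X :=
  [set x | subdiff (@pair_dotp R X Y) phi (x, u) (0, y)].

Definition aligned (B : 'End((X * Y)%type)) :=
  [/\ self_adjoint (@pair_dotp R X Y) B,
      pos_semidef (@pair_dotp R X Y) B,
      range B = [set z | z.1 = 0] &
      B @^-1` [set 0] = [set z | z.2 = 0]].

Definition implementable := forall (c : R) (B : 'End((X * Y)%type)) (p : X * Y),
  0 < c -> aligned B -> exists z, prox_step saddle_map c B p z.

Variables (c : R) (C : 'End(Y)).

Definition norm_op (u : Y) : R := Num.sqrt (dotp (C u) u).

Definition aug_obj (y : Y) (z : X * Y) : \bar R :=
  (phi z - (dotp y z.2)%:E + (c / 2 * norm_op z.2 ^+ 2)%:E)%E.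

Definition aug_lagrangian (x : X) (y : Y) : \bar R :=
  ereal_inf (range (fun u => aug_obj y (x, u))).

Definition dual_block (z : X * Y) : X * Y := (0, (C^-1)%VF z.2).

End Saddle.

(* Main.v *)
Require Import Defs.
From HB Require Import structures.
From mathcomp Require Import all_boot all_order all_algebra.
From mathcomp Require Import sesquilinear.
From mathcomp Require Import all_classical all_reals.
From mathcomp Require Import ereal topology normedtype.
From mathcomp Require Import ring lra.

(* The inclusion [(0, yhat - c C u) \in dphi (x, u)] is the first-order
   optimality condition of (A), and after eliminating [u] it is also the
   proximal step; both for the quadratic perturbation of a convex function, so
   one lemma (argmin_quadE) serves (A) and the proximal problem of [psi].
   Solvability of (A) for every [yhat] says that [I + c C T_*] is onto, which
   makes the monotone map [T_*] maximal. Conversely [T_*] is always contained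
   in the monotone map [T_g], so maximality gives [T_* = T_g]; as [psi] is a
   supremum of affine functions, it is lsc with an affine minorant, and
   [psi + quadratic] attains its minimum for every positive definite quadratic
   form. This yields all the aligned proximal steps without Minty's theorem for
   general maximal monotone maps. *)

Set Implicit Arguments.
Unset Strict Implicit.
Unset Printing Implicit Defensive.

Import Order.TTheory GRing.Theory Num.Theory.
Import numFieldNormedType.Exports.
Import VectorInternalTheory.

Local Open Scope classical_set_scope.
Local Open Scope ring_scope.

(** * Inner products on a Hilbert space and on a product *)

Section Dotp.
Variables (R : realType) (V : finHilbertType R).
Implicit Types x y z : V.

Lemma dotpC x y : dotp x y = dotp y x.
Proof. by rewrite hermC expr0 mul1r. Qed.

Lemma dotpZl (a : R) x y : dotp (a *: x) y = a * dotp x y.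
Proof. by rewrite linearZl_LR. Qed.

Lemma dotpZr (a : R) x y : dotp x (a *: y) = a * dotp x y.
Proof. by rewrite dotpC dotpZl dotpC. Qed.

Lemma dotpDl x y z : dotp (x + y) z = dotp x z + dotp y z.
Proof. exact: linearDl. Qed.

Lemma dotpDr x y z : dotp x (y + z) = dotp x y + dotp x z.
Proof. exact: linearDr. Qed.

Lemma dotpNl x y : dotp (- x) y = - dotp x y.
Proof. exact: linearNl. Qed.

Lemma dotpNr x y : dotp x (- y) = - dotp x y.
Proof. exact: linearNr. Qed.

Lemma dotp0l x : dotp 0 x = 0.
Proof. exact: linear0l. Qed.

Lemma dotp_ge0 x : 0 <= dotp x x.
Proof. by rewrite dotp_normE sqr_ge0. Qed.

Lemma dotp_eq0 x : dotp x x = 0 -> x = 0.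
Proof. by rewrite dotp_normE => /eqP; rewrite sqrf_eq0 normr_eq0 => /eqP. Qed.
End Dotp.

Section PairDotp.
Variables (R : realType) (X Y : finHilbertType R).

Let pd : (X * Y)%type -> (X * Y)%type -> R := @pair_dotp R X Y.

(** Registering [pair_dotp] as a symmetric form lets the lemmas below, stated for any symmetric
    form, apply both to [Y] and to the product. *)
Lemma pair_dotp_bilinear : bilinear_for *%R (@idfun R \; *%R) pd.
Proof.
split=> z a u v; rewrite /pd /pair_dotp /=.
  by rewrite !linearPl; ring.
by rewrite !linearPr /=; ring.
Qed.

Lemma pair_dotp_sym z w : pd z w = (-1) ^+ false * idfun (pd w z).
Proof. by rewrite expr0 mul1r /pd /pair_dotp /= dotpC [dotp z.2 _]dotpC. Qed.

HB.instance Definition _ :=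
  bilinear_isBilinear.Build R _ _ R _ _ (@pair_dotp R X Y) pair_dotp_bilinear.
HB.instance Definition _ :=
  isHermitianSesquilinear.Build R _ false idfun (@pair_dotp R X Y) pair_dotp_sym.
End PairDotp.

(** * First-order optimality for a convex function plus a quadratic *)

Lemma ge0_perturb (R : realFieldType) (A K : R) :
  (forall t : R, 0 < t < 1 -> 0 <= A + t * K) -> 0 <= A.
Proof.
move=> AK; rewrite leNgt; apply/negP => A0.
(* For negative [A] this [t] lies in (0,1) and satisfies t|K| < -A, so A + tK < 0. *)
pose t := - A / (1 + `|K| + 2 * - A).
have K0 := normr_ge0 K; have KK := ler_norm K.
have D0 : 0 < 1 + `|K| + 2 * - A by lra.
have t0 : 0 < t by rewrite divr_gt0//; lra.
have t1 : t < 1 by rewrite ltr_pdivrMr//; lra.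
have tE : t * (1 + `|K| + 2 * - A) = - A by rewrite divfK// gt_eqF.
have := AK t; rewrite t0 t1 => /(_ isT).
nra.
Qed.

Section SymmetricForm.
Variables (R : realType) (U : lmodType R) (d : {symmetric U}).

Lemma symC x y : d x y = d y x.
Proof. by rewrite hermC expr0 mul1r. Qed.

Lemma symZl a x y : d (a *: x) y = a * d x y.
Proof. by rewrite linearZl_LR. Qed.

Lemma symZr a x y : d x (a *: y) = a * d x y.
Proof. by rewrite symC symZl symC. Qed.

Lemma symBl x y z : d (x - y) z = d x z - d y z.
Proof. exact: linearBl. Qed.

Lemma symDr x y z : d x (y + z) = d x y + d x z.
Proof. exact: linearDr. Qed.

Lemma subdiff_monotone (f : U -> \bar R) : monotone_map d (subdiff d f).
Proof.
move=> x y u v [fx xu] [fy yv].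
have := xu y; have := yv x.
rewrite -(fineK fx) -(fineK fy) -!EFinD !lee_fin.
rewrite !linearBr !linearBl /= (symC x u) (symC x v) (symC y u) (symC y v).
lra.
Qed.

Variables (f : U -> \bar R) (Q : {linear U -> U}) (a : U).
Hypotheses (f_proper : proper_fun f) (f_convex : econvex f).
Hypotheses (Q_sa : self_adjoint d Q) (Q_psd : pos_semidef d Q).

Let q z := 2^-1 * d (Q z) z.

Lemma quadD x v : q (x + v) = q x + d (Q x) v + q v.
Proof.
rewrite /q linearD !linearDl !linearDr /= (Q_sa v x) (symC v (Q x)).
lra.
Qed.

Lemma quad_ge0 x : 0 <= q x.
Proof. by rewrite mulr_ge0. Qed.

Lemma quadZ t x : q (t *: x) = t ^+ 2 * q x.
Proof. by rewrite /q linearZZ symZl symZr; ring. Qed.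

(** Forward: compare [x] with [x + t (y - x)], bound [f] there by convexity and divide by [t]; the
    remaining error [t q (y - x)] vanishes as [t] tends to 0. Backward: the expansion [quadD] is
    exact, and its last term is nonnegative. *)
Lemma argmin_quadE x :
  argmin (fun z => f z - (d a z)%:E + (q z)%:E)%E x <->
  subdiff d f x (a - Q x).
Proof.
have [[x0 fx0] f_gtNy] := f_proper; split.
  move=> xmin.
  have fxy : (f x < +oo)%E.
    have := xmin x0; have := f_gtNy x0; have := f_gtNy x; move: fx0.
    by case: (f x) => [r| |] //; case: (f x0).
  have fx : f x \is a fin_num by rewrite fin_numElt fxy f_gtNy.
  split=> // y; have := f_gtNy y.
  case fyE : (f y) => [r| |] // _; last by rewrite leey.
  rewrite -(fineK fx) -EFinD lee_fin -subr_ge0.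
  apply: (@ge0_perturb _ _ (q (y - x))) => t t01.
  have /andP[t0 t1] := t01.
  have := le_trans (xmin (t *: y + (1 - t) *: x))
    (leeD2r _ (leeD2r _ (f_convex y x t01))).
  have -> : t *: y + (1 - t) *: x = x + t *: (y - x).
    by rewrite scalerBl scalerBr scale1r addrCA.
  rewrite fyE -(fineK fx) -!EFinM -!EFinN -!EFinD lee_fin.
  rewrite quadD quadZ symZr [d a (x + _)]symDr symZr symBl => h.
  rewrite -(@pmulr_rge0 _ t) //.
  nra.
move=> [fx xa] y; have := xa y; have := f_gtNy y.
case fyE : (f y) => [r| |] //; last by move=> _ _; exact: leey.
move=> _; rewrite -(fineK fx) -!EFinN -!EFinD !lee_fin => h.
have -> : y = x + (y - x) by rewrite addrC subrK.
rewrite quadD [d a (x + _)]symDr.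
have := quad_ge0 (y - x); move: h; rewrite symBl; lra.
Qed.

End SymmetricForm.

(** * Lower semicontinuity and minimization *)

Section LowerSemicontinuity.
Variables (R : realType) (T : topologicalType).
Implicit Types f : T -> \bar R.

Lemma lsc_cst (e : \bar R) : lower_semicontinuous (fun _ : T => e).
Proof. by move=> x a ae; exists setT => //; exact: filterT. Qed.

Lemma lsc_sup (I : Type) (F : I -> T -> \bar R) :
  (forall i, lower_semicontinuous (F i)) ->
  lower_semicontinuous (fun x => ereal_sup (range (F ^~ x))).
Proof.
move=> F_lsc x a /ereal_sup_gt[_ [i _ <-] /F_lsc[V xV aV]].
exists V => // y /aV /lt_le_trans; apply.
by apply: ereal_sup_ubound; exists i.
Qed.

Lemma lsc_addr f (p : T -> R) : lower_semicontinuous f -> continuous p ->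
  lower_semicontinuous (fun x => f x + (p x)%:E)%E.
Proof.
move=> f_lsc p_cont x a afx.
(* The level splits as a = b + (a - b), so that near [x] each summand stays above its own share. *)
have [b ab bf] : exists2 b : R, a - p x < b & (b%:E < f x)%E.
  case: (f x) afx => [r| |] //.
    rewrite -EFinD lte_fin => h.
    by exists ((a - p x + r) / 2); rewrite ?lte_fin; lra.
  by move=> _; exists (a - p x + 1); rewrite ?ltry//; lra.
have [V xV bV] := f_lsc _ _ bf.
exists (V `&` [set y | a - b < p y]).
  apply: filterI => //; apply: (cvgr_gt (p x)); first exact: p_cont.
  by lra.
move=> y [/bV bfy] /= apy.
have -> : a = b + (a - b) by lra.
by rewrite EFinD lteD.
Qed.

Lemma lsc_compact_min f (K : set T) : compact K -> K !=set0 ->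
  lower_semicontinuous f -> exists2 x, K x & forall y, K y -> (f x <= f y)%E.
Proof.
move=> /compact_near_coveringP K_cover [x0 Kx0] f_lsc.
pose m := ereal_inf (f @` K).
have m_le y : K y -> (m <= f y)%E by move=> Ky; apply: ereal_inf_lbound; exists y.
have [[x [Kx fxm]]|m_lt] := pselect (exists x, K x /\ f x = m).
  by exists x => // y /m_le; rewrite fxm.
have {}m_lt x : K x -> (m < f x)%E.
  move=> Kx; rewrite lt_neqAle m_le// andbT; apply/eqP => mfx.
  by apply: m_lt; exists x.
(* If [m] is not attained, the sets [a < f x] for [a] decreasing to [m] cover
   [K], so by compactness some [a > m] bounds [f] from below on [K]. *)
pose F := filter_from [set b | (m < b)%E] (fun b => [set a | (a <= b)%E]).
have FF : Filter F.
  apply: filter_from_filter; first by exists (f x0); exact: m_lt.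
  move=> a b ma mb; exists (Order.min a b); first by rewrite /= lt_min ma.
  by move=> e /=; rewrite le_min => /andP[].
have [x Kx|b mb Kb] := K_cover _ F (fun a x => (a < f x)%E) FF.
  have [r mr rfx] : exists2 r : R, (m < r%:E)%E & (r%:E < f x)%E.
    have := m_lt _ Kx; case: (f x) => [s| |]; case mE : m => [t| |] //.
    - rewrite lte_fin => ts; exists ((t + s) / 2); rewrite lte_fin; lra.
    - by move=> _; exists (s - 1); rewrite ?ltNyr// lte_fin; lra.
    - by move=> _; exists (t + 1); rewrite ?ltry// lte_fin; lra.
    - by move=> _; exists 0; rewrite ?ltNyr ?ltry.
  have [V xV rV] := f_lsc _ _ rfx.
  exists (V, [set a | (a <= r%:E)%E]) => /=.
    by split=> //; exists r%:E.
  by case=> y a [/= /rV ry /le_lt_trans]; exact.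
suff : (b <= m)%E by rewrite leNgt mb.
apply: le_ereal_inf_tmp => _ [y Ky <-].
have /(_ b) := Kb; rewrite /= lexx => /(_ isT) /(_ _ Ky).
exact: ltW.
Qed.
End LowerSemicontinuity.

(** * Linear and quadratic forms on row vectors *)

Section Coordinates.
Variables (R : realType) (n : nat).

Lemma linear_rV_sum (l : {scalar 'rV[R]_n}) v :
  l v = \sum_i v 0 i * l (delta_mx 0 i).
Proof.
rewrite {1}[v]row_sum_delta linear_sum.
by apply: eq_bigr => i _; rewrite linearZ.
Qed.

Lemma linear_rV_continuous (l : {scalar 'rV[R]_n}) : continuous l.
Proof.
have -> : (l : _ -> R) = \sum_i (fun v : 'rV[R]_n => v 0 i * l (delta_mx 0 i)).
  by apply/funext => v; rewrite linear_rV_sum fct_sumE.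
apply: (big_ind (fun f : 'rV[R]_n -> R => continuous f)).
- exact: (@cst_continuous _ _ (0 : R)).
- by move=> f g cf cg x; exact: (cvgD (cf x) (cg x)).
- move=> i _ x.
  exact: (cvgM (@coord_continuous R 1 n 0 i x) (cvg_cst (l (delta_mx 0 i)))).
Qed.

Lemma linear_rV_bounded (l : {scalar 'rV[R]_n}) :
  exists L, forall v, `|l v| <= L * `|v|.
Proof.
exists (\sum_i `|l (delta_mx 0 i)|) => v.
rewrite linear_rV_sum mulr_suml; apply: le_trans (ler_norm_sum _ _ _) _.
apply: ler_sum => i _; rewrite normrM mulrC ler_wpM2l//.
rewrite [leRHS]/Num.norm /= mx_normrE.
by apply: (le_bigmax _ (fun ij : 'I_1 * 'I_n => `|v ij.1 ij.2|) (0, i)).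
Qed.
End Coordinates.

(** The constant [k] is the minimum of [q] on the compact unit sphere; homogeneity carries the bound
    to all vectors. *)
Lemma quad_rV_coercive (R : realType) n (q : 'rV[R]_n -> R) : continuous q ->
  (forall t v, q (t *: v) = t ^+ 2 * q v) -> (forall v, v != 0 -> 0 < q v) ->
  exists2 k, 0 < k & forall v, k * `|v| ^+ 2 <= q v.
Proof.
move=> q_cont qZ q_gt0.
have q0 : q 0 = 0 by rewrite -(scale0r 0) qZ expr0n mul0r.
pose S := [set v : 'rV[R]_n | `|v| = 1].
have inS v : v != 0 -> S (`|v|^-1 *: v).
  move=> v0; rewrite /S /= normrZ ger0_norm ?invr_ge0// mulVf//.
  by rewrite normr_eq0.
(* The sphere is empty when the only vector is 0, and then any positive constant works. *)
have [[v0 Sv0]|S0] := pselect (S !=set0); last first.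
  exists 1 => // v; have [->|/inS Sv] := eqVneq v 0.
    by rewrite q0 normr0 expr0n mulr0.
  by case: S0; exists (`|v|^-1 *: v).
have S_compact : compact S.
  apply: bounded_closed_compact.
    by exists 1; split=> // x x1 v /= ->; exact: ltW.
  apply: (@closed_comp _ _ (@Num.norm _ 'rV[R]_n) [set 1]).
    by move=> v _; exact: norm_continuous.
  exact: closed_eq.
have q_lsc : lower_semicontinuous (fun v => 0 + (q v)%:E)%E.
  by apply: lsc_addr => //; exact: lsc_cst.
have [u Su qu] := lsc_compact_min S_compact (ex_intro _ _ Sv0) q_lsc.
have u0 : u != 0 by rewrite -normr_eq0 Su oner_eq0.
exists (q u); first exact: q_gt0.
move=> v; have [->|vn0] := eqVneq v 0; first by rewrite q0 normr0 expr0n mulr0.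
have := qu _ (inS _ vn0); rewrite !add0e lee_fin qZ exprVn mulrC.
by rewrite ler_pdivlMr// exprn_gt0// normr_gt0.
Qed.

(** * Existence of minimizers after a positive definite perturbation *)

Section QuadraticPerturbation.
Variables (R : realType) (Y : finHilbertType R).
Variables (n : nat) (r : {linear 'rV[R]_n -> Y}).

(** Compactness is used in the space of row vectors, so forms on [Y] are pulled back along a
    coordinate map [r]. *)
Definition dotp_coord (b : Y) (v : 'rV[R]_n) : R := dotp b (r v).

Fact dotp_coord_is_scalar b : scalar (dotp_coord b).
Proof. by move=> t v w; rewrite /dotp_coord linearP dotpDr dotpZr. Qed.

HB.instance Definition _ b :=
  GRing.isLinear.Build R 'rV[R]_n R *%R (dotp_coord b) (dotp_coord_is_scalar b).

Hypothesis r_inj : injective r.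
Variables (D : {linear Y -> Y}).
Hypothesis D_pd : pos_def dotp D.

Let q v := dotp (D (r v)) (r v).

Lemma quad_coord_continuous : continuous q.
Proof.
have -> : q = \sum_i (fun v : 'rV[R]_n =>
    v 0 i * dotp_coord (D (r (delta_mx 0 i))) v).
  apply/funext => v; rewrite fct_sumE /q {1}[v]row_sum_delta !linear_sum /=.
  rewrite linear_sumlz; apply: eq_bigr => i _.
  by rewrite !linearZZ; exact: dotpZl.
apply: (big_ind (fun f : 'rV[R]_n -> R => continuous f)).
- exact: (@cst_continuous _ _ (0 : R)).
- by move=> f g cf cg x; exact: (cvgD (cf x) (cg x)).
- move=> i _ x.
  exact: (cvgM (@coord_continuous R 1 n 0 i x) (@linear_rV_continuous _ _ _ x)).
Qed.

Lemma quad_coord_coercive :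
  exists2 k, 0 < k & forall v, k * `|v| ^+ 2 <= q v.
Proof.
apply: quad_rV_coercive; first exact: quad_coord_continuous.
  by move=> t v; rewrite /q !linearZZ dotpZl dotpZr mulrA expr2.
move=> v v0; apply: D_pd; rewrite -(linear0 r) (inj_eq r_inj) //.
Qed.

(** The affine minorant of [f] is dominated by the coercive quadratic, so the search for a minimizer
    can be confined to a compact ball. *)
Lemma quad_coord_min (f : 'rV[R]_n -> \bar R) (a b : Y) (e : R) :
  lower_semicontinuous f -> (exists v, f v < +oo)%E ->
  (forall v, (dotp b (r v) + e)%:E <= f v)%E ->
  exists v, argmin (fun v => f v - (dotp a (r v))%:E + (2^-1 * q v)%:E)%E v.
Proof.
move=> f_lsc [v0 fv0] f_ge.
have [k k0 kq] := quad_coord_coercive.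
have [L lL] := linear_rV_bounded (dotp_coord (b - a)).
pose g v := (f v + (2^-1 * q v - dotp a (r v))%:E)%E.
suff [v gv] : exists v, argmin g v.
  have gE w : (f w - (dotp a (r w))%:E + (2^-1 * q w)%:E = g w)%E.
    by rewrite /g EFinD EFinN [((2^-1 * q w)%:E + _)%E]addeC addeA.
  by exists v => w; rewrite !gE.
have g_lsc : lower_semicontinuous g.
  apply: lsc_addr => // v.
  exact: (cvgB (cvgM (@cst_continuous _ _ (2^-1 : R) v) (@quad_coord_continuous v))
    (@linear_rV_continuous _ _ (dotp_coord a) v)).
have g_ge v : (((k / 2 * `|v| - L) * `|v| + e)%:E <= g v)%E.
  rewrite /g; apply: le_trans (leeD2r _ (f_ge v)).
  rewrite -EFinD lee_fin; have := kq v; have := lL v.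
  rewrite /= /dotp_coord dotpDl dotpNl ler_norml => /andP[h1 h2] h3.
  by nra.
have [g0 g0E] : exists g0, g v0 = g0%:E.
  have := f_ge v0; move: fv0; rewrite /g.
  by case: (f v0) => [t| |] // _ _; eexists; rewrite -EFinD.
(* The radius is chosen so that [v0] lies in the ball, while |v| > s forces |v| > 1 and k/2 |v| - L
   > |g0 - e| + 1; the lower bound [g_ge] then exceeds [g0]. *)
pose s := `|v0| + 1 + 2 / k * (`|L| + `|g0 - e| + 1).
have sg v : s < `|v| -> (g v0 < g v)%E.
  move=> vs; apply: lt_le_trans (g_ge v); rewrite g0E lte_fin.
  have v00 := normr_ge0 v0; have LL := ler_norm L; have ge := ler_norm (g0 - e).
  have L0 := normr_ge0 L; have ge0 := normr_ge0 (g0 - e).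
  set w := `|L| + `|g0 - e| + 1 in s vs.
  have kw : w < k / 2 * `|v|.
    have -> : w = k / 2 * (2 / k * w) by field; rewrite gt_eqF.
    rewrite ltr_pM2l ?divr_gt0//; apply: le_lt_trans vs; rewrite /s; lra.
  have w0 : 0 <= 2 / k * w by rewrite mulr_ge0 ?divr_ge0 ?ltW// /w; lra.
  have v1 : 1 < `|v| by apply: le_lt_trans vs; rewrite /s; lra.
  have h : `|g0 - e| + 1 < k / 2 * `|v| - L by move: kw; rewrite /w; lra.
  have : k / 2 * `|v| - L < (k / 2 * `|v| - L) * `|v| by rewrite ltr_pMr//; lra.
  lra.
pose K := [set v : 'rV[R]_n | `|v| <= s].
have K_compact : compact K.
  apply: bounded_closed_compact.
    by exists s; split=> [|x sx v /= vs]; [exact: num_real|exact: le_trans vs (ltW sx)].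
  apply: (@closed_comp _ _ (@Num.norm _ 'rV[R]_n) [set x | x <= s]).
    by move=> v _; exact: norm_continuous.
  exact: closed_le.
have Kv0 : K v0.
  have k2 : 0 <= 2 / k by rewrite divr_ge0 ?ltW.
  by rewrite /K /= /s -addrA lerDl addr_ge0// mulr_ge0 ?addr_ge0.
have [v Kv vmin] := lsc_compact_min K_compact (ex_intro _ _ Kv0) g_lsc.
exists v => w; have [ws|/sg/ltW gw] := leP `|w| s; first exact: vmin.
exact: le_trans (vmin _ Kv0) gw.
Qed.
End QuadraticPerturbation.

(** * Operators aligned with the splitting *)

Section Blocks.
Variables (R : realType) (X Y : finHilbertType R).

(** The block operator with blocks 0 and [D]; [dual_block C] is the case where [D] is the inverse of
    [C]. *)
Definition snd_block (D : Y -> Y) (z : X * Y) : X * Y := (0, D z.2).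

Fact snd_block_is_linear (D : {linear Y -> Y}) : linear (snd_block D).
Proof.
move=> a z w; rewrite /snd_block /= linearP.
by congr (_, _); rewrite /= scaler0 addr0.
Qed.

HB.instance Definition _ (D : {linear Y -> Y}) :=
  GRing.isLinear.Build R _ _ *:%R (snd_block D) (snd_block_is_linear D).

Lemma pair_dotp0l y (z : X * Y) : pair_dotp (0, y) z = dotp y z.2.
Proof. by rewrite /pair_dotp /= dotp0l add0r. Qed.

Lemma snd_block_self_adjoint D :
  self_adjoint dotp D -> self_adjoint (@pair_dotp R X Y) (snd_block D).
Proof.
move=> D_sa z w; rewrite pair_dotp0l D_sa.
by rewrite /pair_dotp /= [dotp z.1 0]dotpC dotp0l add0r.
Qed.

Lemma pos_def_semidef (D : {linear Y -> Y}) :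
  pos_def dotp D -> pos_semidef dotp D.
Proof.
move=> D_pd y; have [->|/D_pd/ltW//] := eqVneq y 0.
by rewrite linear0.
Qed.

Lemma snd_block_pos_semidef D :
  pos_semidef dotp D -> pos_semidef (@pair_dotp R X Y) (snd_block D).
Proof. by move=> D_psd z; rewrite pair_dotp0l. Qed.

Lemma pos_def_eq0 (D : {linear Y -> Y}) y :
  pos_def dotp D -> D y = 0 -> y = 0.
Proof.
move=> D_pd Dy; apply/eqP; apply: contraT => /D_pd.
by rewrite Dy dotp0l ltxx.
Qed.

Lemma aligned_snd_block (D D' : {linear Y -> Y}) :
  self_adjoint dotp D -> pos_def dotp D -> cancel D' D ->
  aligned (linfun (snd_block D)).
Proof.
move=> D_sa D_pd D'K; split.
- by move=> z w; rewrite !lfunE; exact: snd_block_self_adjoint.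
- move=> z; rewrite lfunE /=.
  exact/(snd_block_pos_semidef (pos_def_semidef D_pd)).
- apply/seteqP; split=> [_ [z _ <-]|[x y] /= ->]; first by rewrite lfunE.
  by exists (0, D' y) => //; rewrite lfunE /= /snd_block /= D'K.
- apply/seteqP; split=> [z|[x y] /= ->]; rewrite /= lfunE /= /snd_block /=.
    by case=> /pos_def_eq0; apply.
  by rewrite linear0.
Qed.

Definition snd_restr (B : 'End((X * Y)%type)) (y : Y) : Y := (B (0, y)).2.

Fact snd_restr_is_linear B : linear (snd_restr B).
Proof.
move=> a x y; rewrite /snd_restr.
have -> : (0, a *: x + y) = a *: (0, x) + (0, y) :> X * Y.
  by congr (_, _); rewrite /= scaler0 addr0.
by rewrite linearP.
Qed.

HB.instance Definition _ B :=
  GRing.isLinear.Build R _ _ *:%R (snd_restr B) (snd_restr_is_linear B).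

(** The range condition kills the first output and the kernel condition discards the first input,
    leaving a single block on [Y]. That block is definite because a vector where its quadratic form
    vanishes lies in the kernel of [B]. *)
Lemma aligned_snd_restr B : aligned B ->
  [/\ self_adjoint dotp (snd_restr B), pos_def dotp (snd_restr B) &
      forall z, B z = snd_block (snd_restr B) z].
Proof.
move=> [B_sa B_psd B_range B_ker].
have B1 z : (B z).1 = 0.
  by have : [set z : X * Y | z.1 = 0] (B z) by rewrite -B_range; exists z.
have BE z : B z = snd_block (snd_restr B) z.
  have zE : z = (z.1, 0) + (0, z.2).
    by case: z => x y; congr (_, _); rewrite /= ?addr0 ?add0r.
  have B0 : B (z.1, 0) = 0.
    have : [set z : X * Y | z.2 = 0] (z.1, 0) by [].
    by rewrite -B_ker.
  have -> : B z = B (0, z.2) by rewrite {1}zE (linearD B) /= B0 add0r.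
  by rewrite [LHS]surjective_pairing B1.
have B_dotp y w : pair_dotp (B (0, y)) (0, w) = dotp (snd_restr B y) w.
  by rewrite BE pair_dotp0l.
split=> // [x y|y y0].
  rewrite -B_dotp B_sa dotpC -B_dotp; exact: symC.
rewrite lt_neqAle -{2}B_dotp B_psd andbT eq_sym.
apply/eqP => By0.
suff By : snd_restr B y = 0.
  have : [set z : X * Y | z.2 = 0] (0, y).
    by rewrite -B_ker /= BE /snd_block /= By.
  by move=> /= /eqP; rewrite (negPf y0).
(* A positive semidefinite form vanishing at [y] has [y] in its kernel: test it
   at [y - t v] with [v = D y] and small [t > 0]. *)
apply: dotp_eq0; set v := snd_restr B y.
have qge t : 0 <= t * (2 * dotp v v) + t ^+ 2 * dotp (snd_restr B v) v.
  have := B_psd (0, y + t *: v); rewrite B_dotp.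
  have -> : snd_restr B (y + t *: v) = v + t *: snd_restr B v.
    by rewrite linearD linearZZ.
  rewrite !dotpDl !dotpDr !dotpZl !dotpZr [dotp v y]By0.
  have -> : dotp (snd_restr B v) y = dotp v v.
    by rewrite -B_dotp B_sa /pair_dotp /= dotp0l add0r BE.
  by lra.
apply/eqP; rewrite eq_le dotp_ge0 andbT -oppr_ge0.
apply: (@ge0_perturb _ _ (2^-1 * dotp (snd_restr B v) v)) => t /andP[t0 _].
have := qge (- t); rewrite sqrrN => h.
by rewrite -(@pmulr_rge0 _ (2 * t)) ?mulr_gt0//; lra.
Qed.

End Blocks.

(** * The projected saddle mapping and the dual function *)

(** A conjugate is a supremum of affine functions; since [f] avoids -oo, each term is either finite
    affine or constantly -oo. *)
Lemma fenchel_conjugate_econvex (R : realType) (U : lmodType R)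
    (d : {symmetric U}) (f : U -> \bar R) :
  (forall x, -oo < f x)%E -> econvex (fenchel_conjugate d f).
Proof.
move=> f_gtNy x y t /andP[t0 t1].
apply: ge_ereal_sup => _ [z _ <-].
have conj_ge w : ((d w z)%:E - f z <= fenchel_conjugate d f w)%E.
  by apply: ereal_sup_ubound; exists z.
have := f_gtNy z; have := conj_ge x; have := conj_ge y.
case: (f z) => [s| |] // hy hx _; last by rewrite leNye.
have h1 : (t%:E * ((d x z)%:E - s%:E) <= t%:E * fenchel_conjugate d f x)%E.
  by rewrite lee_pmul2l// lte_fin.
have h2 : ((1 - t)%:E * ((d y z)%:E - s%:E) <=
    (1 - t)%:E * fenchel_conjugate d f y)%E.
  by rewrite lee_pmul2l// lte_fin subr_gt0.
apply: le_trans (leeD h1 h2).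
rewrite -!EFinN -!EFinD lee_fin.
have -> : d (t *: x + (1 - t) *: y) z = t * d x z + (1 - t) * d y z.
  by rewrite (symC d _ z) symDr !symZr (symC d z x) (symC d z y).
by lra.
Qed.

Section Saddle.
Variables (R : realType) (X Y : finHilbertType R) (phi : X * Y -> \bar R).
Hypothesis phi_proper : proper_fun phi.

Lemma dual_fun_ge y z : ((dotp y z.2)%:E - phi z <= dual_fun phi y)%E.
Proof.
by rewrite -pair_dotp0l; apply: ereal_sup_ubound; exists z.
Qed.

Lemma dual_fun_gtNy y : (-oo < dual_fun phi y)%E.
Proof.
have [[z fz] f_gtNy] := phi_proper.
apply: lt_le_trans (dual_fun_ge y z); have := f_gtNy z.
by case: (phi z) fz => [s| |] // _ _; rewrite -EFinN -EFinD ltNyr.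
Qed.

Lemma dual_fun_econvex : econvex (dual_fun phi).
Proof.
move=> x y t t01.
have [_ f_gtNy] := phi_proper.
have := @fenchel_conjugate_econvex _ _ (@pair_dotp R X Y) _ f_gtNy
  (0, x) (0, y) t t01.
rewrite /dual_fun.
by congr (fenchel_conjugate _ _ (_, _) <= _)%E; rewrite /= !scaler0 addr0.
Qed.

(** The inclusion is the equality case of the Fenchel-Young inequality: (x, u) attains the supremum
    defining the dual function at [y]. Using the same point as a competitor at [w] gives the
    subgradient inequality. *)
Lemma saddle_proj_dual y u : saddle_proj phi y u -> dual_map phi y u.
Proof.
case=> x [phi_fin phi_sub].
have psiE : dual_fun phi y = ((dotp y u)%:E - phi (x, u))%E.
  apply/eqP; rewrite eq_le dual_fun_ge andbT.
  apply: ge_ereal_sup => _ [z _ <-].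
  have := phi_sub z; rewrite !pair_dotp0l /=.
  have [_ /(_ z)] := phi_proper.
  case: (phi z) => [s| |] //= _; last by rewrite leNye.
  rewrite -(fineK phi_fin) -!EFinN -!EFinD !lee_fin dotpDr dotpNr; lra.
split=> [|w]; first by rewrite psiE fin_numB phi_fin.
have := dual_fun_ge w (x, u); rewrite psiE /=; apply: le_trans.
rewrite -(fineK phi_fin) -!EFinN -!EFinD !lee_fin.
by rewrite dotpDr dotpNr (dotpC u w) (dotpC u y); lra.
Qed.

Lemma saddle_proj_monotone : monotone_map dotp (saddle_proj phi).
Proof.
move=> x y u v /saddle_proj_dual xu /saddle_proj_dual.
exact: (subdiff_monotone xu).
Qed.

Lemma maximal_saddle_projE :
  maximal_monotone dotp (saddle_proj phi) -> saddle_proj phi = dual_map phi.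
Proof.
move=> [_ T_max]; apply/funext => y; apply/seteqP; split.
  exact: saddle_proj_dual.
apply: T_max; first exact: (@subdiff_monotone _ _ dotp).
by move=> x u; exact: saddle_proj_dual.
Qed.

(** If the dual function were identically +oo, [saddle_proj] would have empty graph, and the
    one-point graph {(0, 0)} would be a strictly larger monotone map. *)
Lemma maximal_dual_proper :
  maximal_monotone dotp (saddle_proj phi) -> proper_fun (dual_fun phi).
Proof.
move=> T_max; split; last exact: dual_fun_gtNy.
apply: contrapT => /forallNP psi_pinf.
have T_empty y u : ~ saddle_proj phi y u.
  move/saddle_proj_dual => [/fin_numP psi_fin _].
  by apply: (psi_pinf y); rewrite ltey; case: psi_fin => _ ->.
have [_ /(_ (fun y => [set u | y = 0 /\ u = 0]))] := T_max.
move=> /(_ _ _ 0 0) /= T0; apply: (T_empty 0 0); apply: T0 => //.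
  by move=> x y u v [-> _] [-> _]; rewrite subrr dotp0l.
by move=> y u /T_empty.
Qed.

Lemma dual_map_prox (D : {linear Y -> Y}) (a : Y) :
  proper_fun (dual_fun phi) -> self_adjoint dotp D -> pos_def dotp D ->
  exists y, dual_map phi y (a - D y).
Proof.
move=> psi_proper D_sa D_pd.
pose r : {linear 'rV[R]_(dim Y) -> Y} := r2v.
pose r' : Y -> 'rV[R]_(dim Y) := v2r.
have r'K : cancel r' r by exact: v2rK.
have r_inj : injective r by exact: r2v_inj.
have [[y0 psi0] psi_gtNy] := psi_proper.
have [[z0 phi0] phi_gtNy] := phi_proper.
have psi_lsc : lower_semicontinuous (dual_fun phi \o r).
  (* Lower semicontinuity comes from the supremum over [z]; where [phi z] is +oo the term is
     constantly -oo. *)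
  have -> : dual_fun phi \o r = fun v => ereal_sup (range (fun z =>
      (- phi z + (dotp_coord r z.2 v)%:E)%E)).
    apply/funext => v /=; congr (ereal_sup (_ @` _)); apply/funext => z.
    by rewrite pair_dotp0l addeC dotpC.
  apply: (@lsc_sup _ _ _ (fun z v => - phi z + (dotp_coord r z.2 v)%:E)%E).
  move=> z; apply: lsc_addr; first exact: lsc_cst.
  exact: (@linear_rV_continuous _ _ (dotp_coord r z.2)).
(* Any point [z0] of the domain of [phi] supplies an affine minorant of the dual function. *)
have psi_ge v :
    ((dotp z0.2 (r v) + - fine (phi z0))%:E <= (dual_fun phi \o r) v)%E.
  apply: le_trans (dual_fun_ge _ z0).
  rewrite EFinD EFinN fineK ?fin_numElt ?phi_gtNy ?phi0 //.
  by rewrite [dotp z0.2 _]dotpC.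
have [|v vmin] := @quad_coord_min _ _ _ _ r_inj _ D_pd _ a _ _ psi_lsc _ psi_ge.
  by exists (r' y0); rewrite /= r'K.
exists (r v).
apply/(@argmin_quadE _ _ dotp _ D a psi_proper dual_fun_econvex D_sa
  (pos_def_semidef D_pd)).
by move=> y; have := vmin (r' y); rewrite /= r'K.
Qed.

(** The inclusion determines the element of [saddle_map] completely, and its first component is 0,
    which is the form required by [saddle_compl]. *)
Lemma prox_step_snd_block (D : Y -> Y) c (p z : X * Y) :
  prox_step (saddle_map phi) c (snd_block D) p z <->
  saddle_compl phi z.2 (- (c^-1 *: D (z.2 - p.2))) z.1.
Proof.
rewrite /prox_step /saddle_compl /=; split.
  case=> w zw /eqP; rewrite addr_eq0 => /eqP wE.
  by move: zw; rewrite /saddle_map /= wE /= scaler0 oppr0.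
move=> h; exists (0, - (c^-1 *: D (z.2 - p.2))) => //.
by congr (_, _); rewrite /= ?scaler0 ?addr0 ?addNr.
Qed.

(** An aligned step only sees its block [D] on [Y], so it reduces to the proximal problem of the
    dual function with operator [c^-1 D]. The equality of the two maps then provides the primal
    component. *)
Lemma dual_implementable :
  proper_fun (dual_fun phi) -> saddle_proj phi = dual_map phi ->
  implementable phi.
Proof.
move=> psi_proper TE c B p c0 /aligned_snd_restr[D_sa D_pd BE].
have cD_sa : self_adjoint dotp (c^-1 \*: snd_restr B).
  by move=> x y /=; rewrite dotpZl D_sa -dotpZr.
have cD_pd : pos_def dotp (c^-1 \*: snd_restr B).
  by move=> y /D_pd Dy /=; rewrite dotpZl mulr_gt0// invr_gt0.
have [y] := dual_map_prox (c^-1 *: snd_restr B p.2) psi_proper cD_sa cD_pd.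
rewrite -TE => -[x] /= xy; exists (x, y).
have -> : (B : X * Y -> X * Y) = snd_block (snd_restr B) by apply/funext.
apply/prox_step_snd_block; rewrite /saddle_compl /=.
by rewrite [snd_restr B _]linearB /= scalerBr opprB.
Qed.

(** * The augmented Lagrangian step and the solvability equivalences *)

Section AugmentedLagrangian.
Variables (C : 'End(Y)) (c : R).
Hypothesis phi_convex : econvex phi.
Hypotheses (C_sa : self_adjoint dotp C) (C_pd : pos_def dotp C) (c_gt0 : 0 < c).

Lemma argmin_aug_objE y x u :
  argmin (aug_obj phi c C y) (x, u) <-> saddle_compl phi (y - c *: C u) u x.
Proof.
pose cC : {linear Y -> Y} := c \*: C.
have cC_sa : self_adjoint dotp cC.
  by move=> v w /=; rewrite dotpZl C_sa -dotpZr.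
have cC_pd : pos_def dotp cC.
  by move=> v /C_pd Cv /=; rewrite dotpZl mulr_gt0.
(* The penalty is half the quadratic form of the block operator with blocks 0 and [cC];
   semidefiniteness of [C] lets the square undo the root in [norm_op]. *)
have -> : aug_obj phi c C y = (fun z => phi z - (pair_dotp (0, y) z)%:E +
    (2^-1 * pair_dotp (snd_block cC z) z)%:E)%E.
  apply/funext => z; rewrite /aug_obj !pair_dotp0l dotpZl /norm_op sqr_sqrtr.
    by rewrite mulrA [c / 2]mulrC.
  exact: pos_def_semidef.
have := @argmin_quadE _ _ (@pair_dotp R X Y) phi (snd_block cC) (0, y)
  phi_proper phi_convex (snd_block_self_adjoint cC_sa)
  (snd_block_pos_semidef (pos_def_semidef cC_pd)) (x, u).
have -> // : (0, y) - snd_block cC (x, u) = (0, y - c *: C u) :> X * Y.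
by congr (_, _); rewrite /= subr0.
Qed.

Lemma pos_def_lfunK : cancel C (C^-1)%VF /\ cancel (C^-1)%VF C.
Proof.
have C_inj : lker C == 0%VS.
  apply/lker0P => u v Cuv; apply/eqP; rewrite -subr_eq0; apply/eqP.
  by apply: (pos_def_eq0 C_pd); rewrite linearB /= Cuv subrr.
by split; [exact: lker0_lfunK|exact: lker0_lfunVK].
Qed.

Lemma dual_stepE (p : X * Y) x y :
  prox_step (saddle_map phi) c (dual_block C) p (x, y) <->
  exists u, saddle_compl phi y u x /\ y = p.2 - c *: C u.
Proof.
have [CK CVK] := pos_def_lfunK.
apply: (iff_trans (@prox_step_snd_block (C^-1)%VF c p (x, y))) => /=.
have uE u : (u = - (c^-1 *: (C^-1)%VF (y - p.2))) <-> (y = p.2 - c *: C u).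
  split=> [->|->].
    rewrite (linearN C) (linearZZ C) /= CVK scalerN opprK scalerA.
    by rewrite divff ?gt_eqF// scale1r addrC subrK.
  rewrite [_ - p.2]addrC addKr (linearN (C^-1)%VF) (linearZZ (C^-1)%VF) /= CK.
  by rewrite scalerN opprK scalerA mulVf ?gt_eqF// scale1r.
split=> [h|[u [h /uE <-//]]].
by eexists; split; [exact: h|exact/uE].
Qed.

Lemma aug_minimizers_maximal :
  (forall y, exists z, argmin (aug_obj phi c C y) z) ->
  maximal_monotone dotp (saddle_proj phi).
Proof.
move=> A_min; split; first exact: saddle_proj_monotone.
move=> S S_mon TS y u Syu.
(* Solving (A) at this point yields (w, v) in the graph of [saddle_proj] with w + cCv = y + cCu.
   Monotonicity of [S] then gives <C(u - v), u - v> <= 0, so v = u and w = y. *)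
have [[x v] /argmin_aug_objE] := A_min (y + c *: C u).
set w := y + _ - _ => xv.
have Tw : saddle_proj phi w v by exists x.
have := S_mon _ _ _ _ Syu (TS _ _ Tw).
have yw : y - w = - (c *: C (u - v)).
  by rewrite /w -addrA opprD addrA subrr add0r (linearB C) /= scalerBr.
rewrite yw dotpNl dotpZl oppr_ge0 pmulr_rle0// => Cuv.
have uv : u = v.
  apply/eqP; rewrite -subr_eq0; apply: contraT => /C_pd.
  by rewrite ltNge Cuv.
by move: yw; rewrite uv subrr linear0 scaler0 oppr0 => /subr0_eq ->.
Qed.

(** Only one instance of implementability is invoked: the given [c] and the block operator built
    from the inverse of [C]. *)
Lemma implementable_aug_minimizers :
  implementable phi -> forall y, exists z, argmin (aug_obj phi c C y) z.
Proof.
move=> phi_impl y; have [CK CVK] := pos_def_lfunK.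
have CV_sa : self_adjoint dotp (C^-1)%VF.
  by move=> v w; rewrite -{1}[w]CVK -C_sa CVK.
have CV_pd : pos_def dotp (C^-1)%VF.
  move=> v v0; rewrite -{2}[v]CVK dotpC; apply: C_pd.
  by apply: contraNneq v0 => CV0; rewrite -[v]CVK CV0 linear0.
have [[x w]] := phi_impl c _ (0, y) c_gt0
  (@aligned_snd_block R X Y _ _ CV_sa CV_pd CK).
have -> : (linfun (snd_block (C^-1)%VF) : X * Y -> X * Y) = dual_block C.
  by apply/funext => z; rewrite lfunE.
move=> /dual_stepE[u [xwu wE]]; exists (x, u); apply/argmin_aug_objE.
by move: xwu; rewrite wE.
Qed.

Lemma maximal_implementable :
  maximal_monotone dotp (saddle_proj phi) -> implementable phi.
Proof.
move=> T_max; apply: dual_implementable; first exact: maximal_dual_proper.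
exact: maximal_saddle_projE.
Qed.

Lemma implementable_maximal :
  implementable phi -> maximal_monotone dotp (saddle_proj phi).
Proof. by move/implementable_aug_minimizers/aug_minimizers_maximal. Qed.

Lemma argmin_two_stage y x u :
  argmin (aug_obj phi c C y) (x, u) <->
  argmin (fun x => aug_lagrangian phi c C x y) x /\
  argmin (fun u => aug_obj phi c C y (x, u)) u.
Proof.
have lag_le x' u' : (aug_lagrangian phi c C x' y <= aug_obj phi c C y (x', u'))%E.
  by apply: ereal_inf_lbound; exists u'.
split=> [xu|[x_min u_min] [x' u']].
  split=> [x'|u']; last exact: xu.
  apply: (le_trans (lag_le x u)).
  by apply: le_ereal_inf_tmp => _ [u' _ <-]; exact: xu.
(* By [u_min], the infimum defining the augmented Lagrangian at [x] is attained at [u]. *)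
apply: le_trans (lag_le x' u'); apply: le_trans (x_min x').
by apply: le_ereal_inf_tmp => _ [v _ <-]; exact: u_min.
Qed.

(* Subtracting two optimality conditions [(0, y - c C u_i) \in dphi (x_i, u_i)],
   monotonicity reads [- c <C (u_1 - u_2), u_1 - u_2> >= 0]. *)
Lemma aug_minimizer_unique y x x' u u' :
  argmin (aug_obj phi c C y) (x, u) -> argmin (aug_obj phi c C y) (x', u') ->
  u = u'.
Proof.
move=> /argmin_aug_objE xu /argmin_aug_objE xu'.
have := @saddle_proj_monotone _ _ u u' (ex_intro _ _ xu) (ex_intro _ _ xu').
have -> : y - c *: C u - (y - c *: C u') = - (c *: C (u - u')).
  by rewrite (linearB C) /= scalerBr !opprB addrC addrA subrK.
rewrite dotpNl dotpZl oppr_ge0 pmulr_rle0// => Cuu'.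
apply/eqP; rewrite -subr_eq0; apply: contraT => /C_pd.
by rewrite ltNge Cuu'.
Qed.

Lemma dual_step_argminE (p : X * Y) x y :
  prox_step (saddle_map phi) c (dual_block C) p (x, y) <->
  exists u, argmin (aug_obj phi c C p.2) (x, u) /\ y = p.2 - c *: C u.
Proof.
apply: (iff_trans (dual_stepE p x y)).
by split=> -[u [xu yE]]; exists u; split=> //; move: xu;
  rewrite ?yE => /argmin_aug_objE.
Qed.

(** All minimizers share the same [u], which fixes [y]; with both fixed, the step constrains [x]
    only through membership in [saddle_compl]. *)
Lemma dual_step_sets (p : X * Y) :
  (exists z, prox_step (saddle_map phi) c (dual_block C) p z) ->
  exists u y,
  [/\ [set u' | exists x, argmin (aug_obj phi c C p.2) (x, u')] = [set u],
      [set y' | exists x,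
        prox_step (saddle_map phi) c (dual_block C) p (x, y')] = [set y] &
      [set x | exists y',
        prox_step (saddle_map phi) c (dual_block C) p (x, y')] =
        saddle_compl phi y u].
Proof.
move=> [[x y] /dual_step_argminE[u [xu yE]]]; exists u, y; split.
- apply/seteqP; split=> [u' [x' xu']|_ ->]; last by exists x.
  exact: aug_minimizer_unique xu' xu.
- apply/seteqP; split=> [y' [x' /dual_step_argminE[u' [xu' ->]]]|_ ->].
    by rewrite /= (aug_minimizer_unique xu' xu).
  by exists x; apply/dual_step_argminE; exists u.
- apply/seteqP; split=> x'.
    move=> [y' /dual_step_argminE[u' [xu' _]]].
    move: (xu'); rewrite -(aug_minimizer_unique xu xu') yE.
    by move/argmin_aug_objE.
  by move=> xyu; exists y; apply/dual_stepE; exists u.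
Qed.

(** The resolvent is first identified for the projected map; the formula for the dual map follows
    once the two maps coincide. *)
Lemma resolvent_saddle_projE (p : X * Y) :
  resolvent (fun u => c *: C u) (saddle_proj phi) p.2 =
  [set y | exists x, prox_step (saddle_map phi) c (dual_block C) p (x, y)].
Proof.
apply/seteqP; split=> y.
  move=> [u [x xyu] yE]; exists x; apply/dual_stepE; exists u.
  by split=> //; rewrite -yE addrK.
move=> [x /dual_stepE[u [xyu yE]]]; exists u; first by exists x.
by rewrite yE subrK.
Qed.

End AugmentedLagrangian.
End Saddle.

Theorem proposition4p8 (R : realType) (X Y : finHilbertType R)
    (phi : X * Y -> \bar R) (C : 'End(Y)) (c : R)
    (phi_closed : lower_semicontinuous phi)
    (phi_proper : proper_fun phi)
    (phi_convex : econvex phi)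
    (C_sa : self_adjoint dotp C)
    (C_pd : pos_def dotp C)
    (c_gt0 : 0 < c) :
  let step (p z : X * Y) := prox_step (saddle_map phi) c (dual_block C) p z in
  let obj := aug_obj phi c C in
  let T_star := saddle_proj phi in
  let T_g := dual_map phi in
  [/\ forall (xhat : X) (yhat : Y) (xp : X) (yp : Y),
        step (xhat, yhat) (xp, yp) <->
        exists up : Y, argmin (obj yhat) (xp, up) /\ yp = yhat - c *: C up,
      forall (yhat : Y) (xp : X) (up : Y),
        argmin (obj yhat) (xp, up) <->
        argmin (fun x => aug_lagrangian phi c C x yhat) xp /\
        argmin (fun u => obj yhat (xp, u)) up,
      forall (xhat : X) (yhat : Y), (exists z, step (xhat, yhat) z) ->
        exists (up yp : Y),
        [/\ [set u | exists x, argmin (obj yhat) (x, u)] = [set up],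
            [set y | exists x, step (xhat, yhat) (x, y)] = [set yp] &
            [set x | exists y, step (xhat, yhat) (x, y)] =
              saddle_compl phi yp up],
      (implementable phi <-> maximal_monotone dotp T_star) /\
      (implementable phi <->
        forall yhat : Y, exists z : X * Y, argmin (obj yhat) z) &
      proper_fun (dual_fun phi) ->
      (implementable phi <-> T_star = T_g) /\
      (implementable phi -> forall (xhat : X) (yhat : Y), exists yp : Y,
        [set y | exists x, step (xhat, yhat) (x, y)] = [set yp] /\
        resolvent (fun u => c *: C u) T_g yhat = [set yp])].
Proof.
move=> step obj T_star T_g; split.
- by move=> xhat yhat xp yp; exact: dual_step_argminE.
- by move=> yhat xp up; exact: argmin_two_stage.
- by move=> xhat yhat; exact: (@dual_step_sets _ _ _ _ _ _ _ _ _ _ _ (xhat, yhat)).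
- have impl_max : implementable phi -> maximal_monotone dotp T_star.
    exact: implementable_maximal.
  have max_impl : maximal_monotone dotp T_star -> implementable phi.
    exact: maximal_implementable.
  split; split=> //; first exact: implementable_aug_minimizers.
  by move=> A_min; apply: max_impl; exact: aug_minimizers_maximal A_min.
- move=> psi_proper.
  have impl_eq : implementable phi -> T_star = T_g.
    move=> phi_impl; apply: maximal_saddle_projE => //.
    exact: implementable_maximal phi_impl.
  split; first by split=> //; exact: dual_implementable.
  move=> phi_impl xhat yhat.
  have [z z_min] := implementable_aug_minimizers phi_proper phi_convex C_sa C_pd
    c_gt0 phi_impl yhat.
  have [|u [y [_ yE _]]] := @dual_step_sets _ _ _ _ phi_proper _ _ phi_convex
    C_sa C_pd c_gt0 (xhat, yhat).
    (* Implementability gives a minimizer in (A), hence a step, hence a unique dual component. *)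
    case: z z_min => x u xu; exists (x, yhat - c *: C u).
    by apply/dual_step_argminE => //; exists u.
  exists y; split=> //; rewrite -impl_eq// -yE.
  exact: (resolvent_saddle_projE _ C_pd c_gt0 (xhat, yhat)).
Qed.
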